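(* Let $X$ be an absolutely continuous random variable with probability density function $f$, cumulative distribution function $F$, support $(a,b)$ with $-\infty\le a<b<\infty$, finite second-order moment, and expected inactivity time $m$. Then $$E\left[\frac{1}{m(X)}\right]\ \ge\ \frac{1}{E[m(X)]},$$ and equality holds if and only if, for some value of the parameter $\gamma>0$, $X$ follows the Type 3 extreme value distribution with cumulative distribution function $$F(t)=\begin{cases}e^{\gamma(t-b)}, & t\in(-\infty,b],\ b\ge 0,\\ 1, & \text{otherwise.}\end{cases}$$
   Context: The support of $X$ is $(a,b)$ where $a=\inf\{t:F(t)>0\}$ and $b=\sup\{t:F(t)<1\}$. The expected inactivity time of $X$ is $m(t)=E[t-X\mid X\le t]=\frac{1}{F(t)}\int_a^t F(x)\,dx$.
   Formalization: The condition b ≥ 0 in the displayed distribution function is dropped: the equality case is characterized for every real endpoint b, since F(t)=e^{γ(t-b)} on t ≤ b also gives equality when b<0 (e.g. b=-1). *)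

(* Defs.v *)
From HB Require Import structures.
From mathcomp Require Import all_boot all_order all_algebra.
From mathcomp Require Import all_classical all_reals all_analysis.

Set Implicit Arguments.
Unset Strict Implicit.
Unset Printing Implicit Defensive.

Import Order.TTheory GRing.Theory Num.Theory.
Import numFieldNormedType.Exports.

Local Open Scope classical_set_scope.
Local Open Scope ring_scope.

Definition is_pdf (d : measure_display) (T : measurableType d) (R : realType)
    (P : probability T R) (X : {RV P >-> R}) (f : R -> R) : Prop :=
  [/\ measurable_fun setT f,
      forall x, 0 <= f x &
      forall A : set R, measurable A ->
        distribution P X A = (\int[lebesgue_measure]_(x in A) (f x)%:E)%E].

(* The interval spanned by the distribution of X; the density may still vanish
   on parts of `]a, b[`. *)
Definition is_support (d : measure_display) (T : measurableType d)
    (R : realType) (P : probability T R) (X : {RV P >-> R}) (a b : \bar R) :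
    Prop :=
  a = ereal_inf [set t%:E | t in [set t : R | (0 < cdf X t)%E]] /\
  b = ereal_sup [set t%:E | t in [set t : R | (cdf X t < 1)%E]].

(* E[Y | A] for an event A, i.e. E[Y 1_A] / P(A); the value is 0 when
   P(A) = 0. *)
Definition cond_expectation (d : measure_display) (T : measurableType d)
    (R : realType) (P : probability T R) (Y : T -> R) (A : set T) : R :=
  fine 'E_P[fun w => (Y w * \1_A w)%R] / fine (P A).

(* m(t) = E[t - X | X <= t]. Its junk value 0 at points t with F(t) = 0 is
   harmless in E[m(X)] and E[1/m(X)], since F(X) > 0 almost surely. *)
Definition expected_inactivity_time (d : measure_display)
    (T : measurableType d) (R : realType) (P : probability T R)
    (X : {RV P >-> R}) (t : R) : R :=
  cond_expectation P (fun w => t - X w) [set w | X w <= t].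

(* This is the distribution function of b minus an exponential variable of
   rate gamma, for any real b: no sign condition on b is imposed, since these
   laws have constant expected inactivity time 1/gamma for b < 0 as well. *)
Definition type3_cdf (R : realType) (gamma b t : R) : R :=
  if t <= b then expR (gamma * (t - b)) else 1.

(* Main.v *)
Require Import Defs.
From HB Require Import structures.
From mathcomp Require Import all_boot all_order all_algebra.
From mathcomp Require Import all_classical all_reals all_analysis.
From mathcomp Require Import measurable_realfun ring lra.

Import Order.TTheory GRing.Theory Num.Theory.
Import numFieldNormedType.Exports.

(* The inequality, with equality only if [m(X)] is almost surely constant, comes
   from integrating [1/y + c^2 y = 2 c + (1 - c y)^2 / y] at [y = m(X)],
   [c = 1 / E m(X)].
   Write [m = G / F] with [G(t) = E[(t - X) 1_{X <= t}]]. As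
   [F(u) (v - u) <= G(v) - G(u) <= F(v) (v - u)] for [u <= v] and [F] is
   continuous, [G' = F]. If [m(X) = mu] almost surely, then [G = mu F] on a
   closed set of full measure; the gaps of this set carry no mass, so [F] is
   constant on them while [G] would grow, hence [G = mu F] on all of
   [(-oo, b]]. Solving [G' = G / mu] with [F(b) = 1] gives the type 3 law, and
   in particular [a = -oo]. Conversely, for the type 3 law [G - F / gamma] is
   constant on [(-oo, b]] and tends to 0 at [-oo], because
   [|t| G(t) <= E[X^2]]. *)

Local Open Scope classical_set_scope.
Local Open Scope ring_scope.

(** * Functions with the slopes of a distribution function *)

(** The slope bounds, taken on [[t, t + h]] or [[t + h, t]] by the sign of [h], put the difference
    quotient between [F t] and [F (t + h)]. Squeezing it between [F t - |F (t + h) - F t|] and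
    [F t + |F (t + h) - F t|] treats both signs at once. *)
Lemma is_derive_of_slopes (R : realType) (F G : R -> R) :
  continuous F ->
  (forall u v, u <= v -> F u * (v - u) <= G v - G u <= F v * (v - u)) ->
  forall t : R, is_derive t 1 G (F t).
Proof.
move=> cF slope t.
have lim : h^-1 *: (G (h *: 1 + t) - G t) @[h --> (0:R)^'] --> F t.
  have Fth : F (h *: 1 + t) @[h --> (0:R)] --> F t.
    rewrite -[X in _ --> F X]add0r -[X in _ --> F (X + _)](scale0r (1 : R)).
    apply: (cvg_comp (fun h : R => h *: 1 + t) F); last exact: cF.
    apply: cvgD; last exact: cvg_cst.
    by apply: cvgZr_tmp; exact: cvg_id.
  have dist0 : `|F (h *: 1 + t) - F t| @[h --> (0:R)^'] --> (0 : R).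
    apply/norm_cvg0P; rewrite -[X in _ --> X](subrr (F t)).
    by apply: cvgB; [exact: cvg_within_filter Fth|exact: cvg_cst].
  have low : F t - `|F (h *: 1 + t) - F t| @[h --> (0:R)^'] --> F t.
    by rewrite -[X in _ --> X]subr0; apply: cvgB => //; exact: cvg_cst.
  have upp : F t + `|F (h *: 1 + t) - F t| @[h --> (0:R)^'] --> F t.
    by rewrite -[X in _ --> X]addr0; apply: cvgD => //; exact: cvg_cst.
  apply: (squeeze_cvgr _ low upp).
  near=> h.
  have h0 : h != 0 by near: h; exact: nbhs_dnbhs_neq.
  rewrite -![_ *: _]/(_ * _) mulr1.
  have := ler_norm (F (h + t) - F t); have := ler_norm (F t - F (h + t)).
  rewrite distrC; set n := `|_| => n1 n2.
  have [hlt|hgt|heq] := ltgtP h 0; last by rewrite heq eqxx in h0.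
  - have := slope (h + t) t; rewrite gerDr (ltW hlt) => /(_ isT)/andP[s1 s2].
    by apply/andP; split; rewrite ?ler_ndivlMl ?ler_ndivrMl//; nra.
  - have := slope t (h + t); rewrite lerDr (ltW hgt) => /(_ isT)/andP[s1 s2].
    by apply/andP; split; rewrite ?ler_pdivlMl ?ler_pdivrMl//; nra.
split; first by apply/cvg_ex; exists (F t).
exact/cvg_lim.
Unshelve. all: by end_near. Qed.

Lemma eq_of_is_derive_0 (R : realType) (f : R -> R) (t b : R) :
  continuous f -> t <= b -> (forall x, x < b -> is_derive x 1 f 0) ->
  f t = f b.
Proof.
move=> cf tb df.
have [||c _ /eqP] := @MVT_segment R f (cst 0) t b tb.
- by move=> x /itvP xtb; apply: df; rewrite xtb.
- exact: continuous_subspaceT.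
- by rewrite mul0r subr_eq0 => /eqP.
Qed.

Section tail_integral.
Context (R : realType) (F G : R -> R) (b : R).
Hypothesis dG : forall t : R, is_derive t 1 G (F t).

Let cG : continuous G.
Proof.
move=> t; apply: differentiable_continuous; apply/derivable1_diffP.
by case: (dG t).
Qed.

Lemma proportional_expR (mu : R) : 0 < mu -> continuous F -> F b = 1 ->
  (forall t, t < b -> G t = mu * F t) ->
  forall t, t <= b -> F t = expR (mu^-1 * (t - b)).
Proof.
move=> mu0 cF Fb GF t tb.
(* The identity is given strictly left of [b]; left limits extend it to [b]. *)
have GFb : G b = mu * F b.
  apply: (@cvg_unique _ _ (G x @[x --> b^'-])) => //.
  - exact/cvg_at_left_filter/cG.
  - apply: (@cvg_trans _ ((fun x => mu * F x) @ b^'-)).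
      apply: near_eq_cvg; near=> x.
      by rewrite GF//; near: x; exact: nbhs_left_lt.
    by apply: cvgM; [exact: cvg_cst|exact/cvg_at_left_filter/cF].
have {}GF x : x <= b -> G x = mu * F x.
  by rewrite le_eqVlt => /orP[/eqP ->//|/GF].
(* Integrating factor for [G' = G / mu]: the product [G * e] has derivative 0 left of [b]. *)
pose e (x : R) := expR (- (mu^-1 * (x - b))).
have de (x : R) : is_derive x 1 e (- mu^-1 * e x).
  rewrite /e; apply: trigger_derive.
  by rewrite /GRing.scale/=; ring.
have : (G \* e) t = (G \* e) b.
  apply: eq_of_is_derive_0 => //.
    move=> x; apply: cvgM; first exact: cG.
    apply: differentiable_continuous; apply/derivable1_diffP.
    by case: (de x).
  move=> x xb; apply: trigger_derive.
  by rewrite /GRing.scale/= GF ?ltW//; field; rewrite gt_eqF.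
rewrite /= /e !GF// Fb subrr mulr0 oppr0 expR0 !mulr1 expRN => /eqP.
rewrite -mulrA -subr_eq0 -[X in _ - X]mulr1 -mulrBr mulf_eq0 gt_eqF//= subr_eq0.
by move=> /eqP/divr1_eq.
Unshelve. all: by end_near. Qed.

(** No limit at -oo is taken: a nonzero value of the constant [G - F / gamma] is refuted at one
    explicit point far to the left. A negative one contradicts [G >= 0], a positive one the decay
    bound [C]. *)
Lemma expR_proportional (gamma C : R) : 0 < gamma ->
  (forall t, 0 <= G t) -> (forall t, t < 0 -> - t * G t <= C) ->
  (forall t, t <= b -> F t = expR (gamma * (t - b))) ->
  forall t, t <= b -> G t = gamma^-1 * F t.
Proof.
move=> g0 G0 GC FE.
(* The exponential stands in for [F]: it is differentiable on the whole line and equals [F] up to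
   [b]. *)
pose e (x : R) := G x - gamma^-1 * expR (gamma * (x - b)).
have de (x : R) : is_derive x 1 e (F x - expR (gamma * (x - b))).
  rewrite /e; apply: trigger_derive.
  by rewrite /GRing.scale/=; field; rewrite gt_eqF.
have ecst t : t <= b -> e t = e b.
  move=> tb; apply: eq_of_is_derive_0 => //.
    move=> x; apply: differentiable_continuous; apply/derivable1_diffP.
    by case: (de x).
  by move=> x xb; have := de x; rewrite FE ?ltW// subrr.
suff eb0 : e b = 0.
  move=> t tb; have := ecst t tb; rewrite eb0 /e FE// => /eqP.
  by rewrite subr_eq0 => /eqP.
have [eb|eb|//] := ltgtP (e b) 0.
- (* with [x = gamma (b - t)], [expR (- x) <= (1 + x)^-1] *)
  pose k := - e b; pose x := (k * gamma)^-1.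
  have k0 : 0 < k by rewrite /k; lra.
  have x0 : 0 < x by rewrite invr_gt0 mulr_gt0.
  pose t := b - gamma^-1 * x.
  have tb : t <= b by rewrite /t gerBl ltW// mulr_gt0// invr_gt0.
  have := ecst t tb; rewrite {1}/e.
  have -> : gamma * (t - b) = - x by rewrite /t; field; rewrite gt_eqF.
  have Gt := G0 t.
  have e1 := expR_ge1Dx x.
  have ex : expR x * expR (- x) = 1 by rewrite -expRD subrr expR0.
  have ep := expR_gt0 (- x).
  move=> ee.
  (* The choice of [x] gives [gamma * k <= expR (- x) <= (1 + x)^-1 < x^-1 = gamma * k], a
     contradiction. *)
  have h1 : gamma * k <= expR (- x).
    rewrite -ler_pdivlMl//. rewrite /k -ee; lra.
  have h2 : x * (gamma * k) = 1.
    by rewrite /x; field; rewrite !gt_eqF.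
  have h3 : 0 < gamma * k by rewrite mulr_gt0.
  nra.
(* Here [G t >= e b], so [- t * G t >= |C| + (|b| + 1) * e b > C]. The summand [|b|] ensures
   [t <= b], and 1 ensures [t < 0]. *)
- pose t := - (`|C| / e b + `|b| + 1).
  have Cb : 0 <= `|C| / e b by rewrite divr_ge0// ltW.
  have nb := normr_ge0 b.
  have lb : - b <= `|b| by rewrite -normrN ler_norm.
  have t0 : t < 0 by rewrite /t; lra.
  have tb : t <= b by rewrite /t; lra.
  have := ecst t tb; rewrite {1}/e => ee.
  have ep : 0 < gamma^-1 * expR (gamma * (t - b)).
    by rewrite mulr_gt0 ?invr_gt0 ?expR_gt0.
  have eG : e b <= G t by lra.
  have := GC t t0.
  have CC : `|C| / e b * e b = `|C| by rewrite divfK ?gt_eqF.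
  have := ler_norm C.
  have : - t * e b <= - t * G t by rewrite ler_wpM2l//; lra.
  rewrite {1}/t opprK !mulrDl CC mul1r.
  have : 0 <= `|b| * e b by rewrite mulr_ge0// ltW.
  lra.
Qed.

End tail_integral.

(* With [u] and [v] the points of the closed set [G = mu F] nearest to [t] on
   either side, [F u = F v], so that
   [F u (v - u) <= G v - G u = mu (F v - F u) = 0] and [u = t = v]. *)
Lemma proportional_between (R : realType) (F G : R -> R) (mu : R) :
  continuous F -> continuous G ->
  {homo F : u v / u <= v} ->
  (forall u v, u <= v -> F u * (v - u) <= G v - G u) ->
  (forall u v, F u < F v -> exists2 s, u < s < v & G s = mu * F s) ->
  forall p t q : R, F p < F t -> F t < F q -> 0 < F t -> G t = mu * F t.
Proof.
move=> cF cG Fnd slope dense p t q Fpt Ftq Ft.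
pose S := [set s | G s - mu * F s = 0].
have cS : closed S.
  apply: (@closed_comp _ _ (fun s => G s - mu * F s) [set 0]).
    move=> x _; apply: cvgB; first exact: cG.
    by apply: cvgM; [exact: cvg_cst|exact: cF].
  exact: closed_eq.
have SP s : S s <-> G s = mu * F s.
  by rewrite /S/=; split=> [/eqP|->]; rewrite ?subrr// subr_eq0 => /eqP.
have ct (x : R) : closed [set s : R | s <= x] by exact: closed_le.
have ct' (x : R) : closed [set s : R | x <= s] by exact: closed_ge.
pose A := S `&` [set s | s <= t]; pose B := S `&` [set s | t <= s].
(* The points [p] and [q] make [S] nonempty on both sides of [t]. *)
have [|a /andP[_ at_] /SP Sa] := dense p t; first by [].
have [|b /andP[tb _] /SP Sb] := dense t q; first by [].
have An0 : A !=set0 by exists a; split => //; exact: ltW.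
have Bn0 : B !=set0 by exists b; split => //; exact: ltW.
have Aub : has_ubound A by exists t => s [].
have Blb : has_lbound B by exists t => s [].
have [Su ut] : A (sup A).
  by apply: (closedI cS (ct t)); exact: closure_sup.
have [Sv tv] : B (inf B).
  apply: itv_closed_infimums => //; first exact: closedI cS (ct' t).
  by split=> [x Bx|x Bx]; [exact: ge_inf|exact: lb_le_inf].
(* A strict increase of [F] over the gap would put a point of [S] strictly between [sup A] and
   [inf B]. *)
have Fuv : F (inf B) <= F (sup A).
  rewrite leNgt; apply/negP => /dense[s /andP[us sv] /SP Ss].
  have [st|/ltW ts] := leP s t.
    by move: us; rewrite ltNge => /negP; apply; apply: ub_le_sup.
  by move: sv; rewrite ltNge => /negP; apply; apply: ge_inf.
have Fu : 0 < F (sup A) by exact: lt_le_trans Ft (le_trans (Fnd _ _ tv) Fuv).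
have uv := le_trans ut tv.
have FE : F (inf B) = F (sup A) by apply/eqP; rewrite eq_le Fuv Fnd.
have := slope _ _ uv.
move/SP: (Sv) => ->; move/SP: (Su) => ->.
rewrite FE subrr pmulr_rle0// subr_le0 => vu.
have -> : t = sup A by apply/eqP; rewrite eq_le ut (le_trans tv vu).
exact/SP.
Qed.

(** * Jensen's inequality for the inverse *)

(** Inversion is continuous on the open complement of 0, and the singleton is handled apart. *)
Lemma measurable_inv (R : realType) :
  measurable_fun setT (GRing.inv : R -> R).
Proof.
rewrite -(setvU [set (0:R)]); apply/measurable_funU => //.
  exact: measurableC.
split; last exact: measurable_fun_set1.
apply: open_continuous_measurable_fun.
  by rewrite openC; exact: closed_eq.
by move=> x; rewrite inE => /eqP x0; exact: inv_continuous.
Qed.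

Lemma probability_ae_False d (T : measurableType d) (R : realType)
  (P : probability T R) : ~ {ae P, forall w : T, False}.
Proof.
move=> [N [mN PN0 TN]].
have NT : N = setT by apply/seteqP; split => // w _; apply: TN => /=.
by have := probability_setT P; rewrite -NT PN0 => /esym/eqP; rewrite onee_eq0.
Qed.

Lemma expectation_eq0_ae d (T : measurableType d) (R : realType)
    (P : probability T R) (Z : T -> R) :
  measurable_fun setT Z ->
  (forall w, 0 <= Z w) -> ('E_P[Z] = 0)%E -> {ae P, forall w, Z w = 0}.
Proof.
move=> mZ Z0; rewrite unlock => EZ.
have mZE : measurable_fun setT (EFin \o Z) by exact/measurable_EFinP.
have : ae_eq P setT (EFin \o Z) (cst 0%E).
  apply/(ae_eq_integral_abs P measurableT mZE); rewrite -EZ.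
  by apply: eq_integral => w _; rewrite gee0_abs// lee_fin.
by apply: filterS => w /(_ I) [].
Qed.

Lemma expectation_cst_ae d (T : measurableType d) (R : realType)
    (P : probability T R) (Y : T -> R) (y : R) :
  measurable_fun setT Y -> {ae P, forall w, Y w = y} -> ('E_P[Y] = y%:E)%E.
Proof.
move=> mY Yy; rewrite -(expectation_cst P y) unlock.
apply: ae_eq_integral => //; [exact/measurable_EFinP| |].
  exact/measurable_EFinP/measurable_cst.
by apply: filterS Yy => w /= ->.
Qed.

Section expectation_inv.
Context {d : measure_display} {T : measurableType d} {R : realType}
  (P : probability T R).
Variable Y : T -> R.
Hypothesis mY : measurable_fun setT Y.
Hypothesis Y0 : forall w, 0 <= Y w.
Hypothesis Ypos : {ae P, forall w, 0 < Y w}.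

Let mYV : measurable_fun setT (fun w => (Y w)^-1).
Proof. exact: measurableT_comp (measurable_inv R) mY. Qed.

Let YV0 w : 0 <= (Y w)^-1. Proof. by rewrite invr_ge0. Qed.

Let EY_gt0 : (0 < 'E_P[Y])%E.
Proof.
rewrite lt0e expectation_ge0// andbT; apply/eqP => EY.
apply: (@probability_ae_False _ _ _ P).
apply: filterS2 Ypos (expectation_eq0_ae _ _ _ _ _ mY Y0 EY) => w + Yw0.
by rewrite Yw0 ltxx.
Qed.

Let EYV_gt0 : (0 < 'E_P[fun w => (Y w)^-1%R])%E.
Proof.
rewrite lt0e expectation_ge0// andbT; apply/eqP => EY.
apply: (@probability_ae_False _ _ _ P).
apply: filterS2 Ypos (expectation_eq0_ae _ _ _ _ _ mYV YV0 EY) => w + Yw0.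
by rewrite -invr_gt0 Yw0 ltxx.
Qed.

(* Integrated form of [1 / Y + c^2 Y = 2 c + (1 - c Y)^2 / Y], [c = 1 / E Y]. *)
Let tangent (y : R) : ('E_P[Y] = y%:E)%E ->
  ('E_P[fun w => (Y w)^-1%R] + (y^-1)%R%:E =
   'E_P[fun w => ((1 - y^-1 * Y w) ^+ 2 / Y w)%R] + (2 * y^-1)%R%:E)%E.
Proof.
move=> EY.
have y0 : 0 < y by rewrite -lte_fin -EY.
have mD : measurable_fun setT (fun w => (1 - y^-1 * Y w) ^+ 2 / Y w).
  apply: measurable_funM mYV; apply: measurable_funX.
  by apply: measurable_funB => //; exact: measurable_funM.
have D0 w : 0 <= (1 - y^-1 * Y w) ^+ 2 / Y w by rewrite divr_ge0// sqr_ge0.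
(* Additivity is used for nonnegative integrands, so [E[1 / Y]] may be infinite. *)
transitivity (\int[P]_w ((Y w)^-1%R%:E + (y^-1 ^+ 2 * Y w)%R%:E))%E.
  rewrite ge0_integralD//.
  - rewrite unlock; congr (_ + _)%E.
    under eq_integral do rewrite EFinM.
    rewrite ge0_integralZl//.
    + move: EY; rewrite unlock => ->; rewrite -EFinM; congr (_%:E).
      by field; rewrite gt_eqF.
    + exact/measurable_EFinP.
    + by move=> w _; rewrite lee_fin.
    + by rewrite lee_fin sqr_ge0.
  - by move=> w _; rewrite lee_fin.
  - exact/measurable_EFinP.
  - by move=> w _; rewrite lee_fin mulr_ge0// sqr_ge0.
  - by apply/measurable_EFinP; exact: measurable_funM.
transitivity
  (\int[P]_w (((1 - y^-1 * Y w) ^+ 2 / Y w)%R%:E + (2 * y^-1)%R%:E))%E.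
  (* The pointwise identity fails where [Y w = 0], the inverse being 0 there; hence equality almost
     everywhere. *)
  apply: ge0_ae_eq_integral => //.
  - by apply/measurable_EFinP/measurable_funD => //; exact: measurable_funM.
  - by apply/measurable_EFinP/measurable_funD.
  - by move=> w _; rewrite lee_fin addr_ge0// mulr_ge0// sqr_ge0.
  - by move=> w _; rewrite lee_fin addr_ge0// mulr_ge0// invr_ge0 ltW.
  apply: filterS Ypos => w Yw0 _ /=; rewrite -!EFinD; congr (_%:E).
  by field; rewrite !gt_eqF.
rewrite ge0_integralD//.
- by rewrite unlock integral_cst//= probability_setT mule1.
- by move=> w _; rewrite lee_fin.
- exact/measurable_EFinP.
- by move=> w _; rewrite lee_fin mulr_ge0// invr_ge0 ltW.
Qed.

Lemma expectation_inv_ge : (('E_P[Y])^-1 <= 'E_P[fun w => (Y w)^-1%R])%E.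
Proof.
move: EY_gt0; case EY : ('E_P[Y])%E => [y| |]//; rewrite ?lte_fin => y0.
  have := tangent y EY; rewrite inver gt_eqF// => tY.
  rewrite -(@leeD2rE _ (y^-1)%:E)// tY -EFinD.
  rewrite (_ : y^-1 + y^-1 = 2 * y^-1); last by ring.
  rewrite leeDr// expectation_ge0// => w.
  by rewrite divr_ge0// sqr_ge0.
(* If [E Y] is +oo, its inverse is 0. *)
by rewrite invey expectation_ge0.
Qed.

(** An infinite [E Y] would force [E[1 / Y] = 0], against positivity. Otherwise [tangent] leaves the
    nonnegative defect [(1 - Y / y)^2 / Y] with expectation 0, so it vanishes almost surely. *)
Lemma expectation_inv_eq : ('E_P[fun w => (Y w)^-1%R] = ('E_P[Y])^-1)%E ->
  exists2 y : R, 0 < y & {ae P, forall w, Y w = y}.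
Proof.
move: EY_gt0; case EY : ('E_P[Y])%E => [y| |]//; rewrite ?lte_fin => y0;
  last first.
  by rewrite invey => EYV0; move: EYV_gt0; rewrite EYV0 ltxx.
rewrite inver gt_eqF// => EYV; exists y => //.
have D0 w : 0 <= (1 - y^-1 * Y w) ^+ 2 / Y w by rewrite divr_ge0// sqr_ge0.
have := tangent y EY; rewrite EYV -EFinD.
move=> tD; have ED : 'E_P[fun w => ((1 - y^-1 * Y w) ^+ 2 / Y w)%R]%E = 0%E.
  move: tD; case: ('E_P[_])%E => [e [tD]| |]//; congr (_%:E); lra.
have mD : measurable_fun setT (fun w => (1 - y^-1 * Y w) ^+ 2 / Y w).
  apply: measurable_funM mYV; apply: measurable_funX.
  by apply: measurable_funB => //; exact: measurable_funM.
apply: filterS2 Ypos (expectation_eq0_ae _ _ _ _ _ mD D0 ED) => w Yw /eqP.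
rewrite mulf_eq0 invr_eq0 (gt_eqF Yw) orbF sqrf_eq0 subr_eq0 => /eqP Yy.
have -> : Y w = y * (y^-1 * Y w) by field; rewrite gt_eqF.
by rewrite -Yy mulr1.
Qed.

End expectation_inv.

(** * The expected inactivity time *)

Section lower_partial_moment.
Context {d : measure_display} {T : measurableType d} {R : realType}
  (P : probability T R).
Implicit Types (X : {RV P >-> R}) (t u v : R) (w : T).

Definition real_cdf X t : R := fine (cdf X t).

(** The positive part of [t - X], written as the very integrand of [cond_expectation] in [m]. *)
Definition shortfall X t w : R := (t - X w) * \1_[set w | X w <= t] w.

(** The function [G] of the opening comment, numerator of [m]. *)
Definition lower_partial_moment X t : R := \int[P]_w shortfall X t w.

Lemma preimage_cdf X t : X @^-1` `]-oo, t] = [set w | X w <= t].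
Proof. by apply/seteqP; split => w /=; rewrite in_itv. Qed.

Lemma measurable_le X t : measurable [set w | X w <= t].
Proof. by rewrite -preimage_cdf; exact: measurable_funPTI. Qed.

Lemma cdfE X t : cdf X t = P [set w | X w <= t].
Proof. by rewrite /cdf /distribution /pushforward preimage_cdf. Qed.

Lemma EFin_real_cdf X t : (real_cdf X t)%:E = cdf X t.
Proof. by rewrite fineK// fin_num_measure. Qed.

Lemma real_cdf_ge0 X t : 0 <= real_cdf X t.
Proof. by rewrite fine_ge0// cdf_ge0. Qed.

Lemma le_real_cdf X : {homo real_cdf X : u v / u <= v}.
Proof. by move=> u v uv; rewrite -lee_fin !EFin_real_cdf cdf_nondecreasing. Qed.

Lemma indic_le X t w : \1_[set w | X w <= t] w = (X w <= t)%R%:R :> R.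
Proof. by rewrite indicE mem_setE. Qed.

Lemma shortfall_ge0 X t w : 0 <= shortfall X t w.
Proof.
rewrite /shortfall indic_le; case: (leP (X w) t) => Xt /=.
  by rewrite mulr1 subr_ge0.
by rewrite mulr0.
Qed.

Lemma lower_partial_moment_ge0 X t : 0 <= lower_partial_moment X t.
Proof. by apply: Rintegral_ge0 => w _; exact: shortfall_ge0. Qed.

Lemma expected_inactivity_timeE X t :
  expected_inactivity_time X t = lower_partial_moment X t / real_cdf X t.
Proof.
rewrite /expected_inactivity_time /cond_expectation /real_cdf cdfE.
by rewrite unlock.
Qed.

Lemma Rintegral_indic_le X t :
  \int[P]_w \1_[set w | X w <= t] w = real_cdf X t.
Proof.
rewrite /Rintegral integral_indic//; last exact: measurable_le.
by rewrite setIT /real_cdf cdfE.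
Qed.

Section finite_second_moment.
Variable X : {RV P >-> R}.
Hypothesis X2 : ('E_P[fun w => (X w ^+ 2)%R] < +oo)%E.
Local Notation F := (real_cdf X).
Local Notation G := (lower_partial_moment X).

Let iX2 : P.-integrable setT (EFin \o (fun w => X w ^+ 2)).
Proof.
apply/integrableP; split; first exact/measurable_EFinP/measurable_funX.
move: X2; rewrite unlock; apply: le_lt_trans; apply: ge0_le_integral => //.
- by apply: measurableT_comp => //; exact/measurable_EFinP/measurable_funX.
- exact/measurable_EFinP/measurable_funX.
- by move=> w _ /=; rewrite lee_fin ger0_norm// sqr_ge0.
Qed.

Lemma integrable_shortfall t : P.-integrable setT (EFin \o shortfall X t).
Proof.
(* A dominating function: [- x <= 1 + x ^+ 2], by [(x + 1) ^+ 2 >= 0] and [x ^+ 2 >= 0]. *)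
have ib : P.-integrable setT
    (EFin \o (fun w => `|t| + 1 + X w ^+ 2)).
  have ic := finite_measure_integrable_cst P (`|t| + 1) measurableT.
  exact: (integrableD measurableT ic iX2).
apply: le_integrable ib => //.
  apply/measurable_EFinP; apply: measurable_funM.
    exact: measurable_funB.
  exact/measurable_indic/measurable_le.
move=> w _ /=; rewrite lee_fin (ger0_norm (shortfall_ge0 _ _ _)).
apply: le_trans (ler_norm _).
rewrite /shortfall indic_le; have := ler_norm t; have := normr_ge0 t.
have := sqr_ge0 (X w); have := sqr_ge0 (X w + 1).
rewrite sqrrD; case: (leP (X w) t) => Xt /=; lra.
Qed.

(** The growth of the shortfall from [u] to [v] is [v - u] where [X <= u], is 0 where [X > v], and
    lies between these elsewhere; integrate. *)
Lemma lower_partial_moment_slopes u v : u <= v ->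
  F u * (v - u) <= G v - G u <= F v * (v - u).
Proof.
move=> uv.
have ii t : P.-integrable setT (EFin \o (\1_[set w | X w <= t] : T -> R)).
  exact/integrable_indic/measurable_le.
have iZ t : P.-integrable setT
    (EFin \o (fun w => (v - u) * \1_[set w | X w <= t] w)).
  exact: (integrableZl measurableT (v - u) (ii t)).
have FE t : F t * (v - u) =
    \int[P]_w ((v - u) * \1_[set w | X w <= t] w).
  by rewrite RintegralZl// Rintegral_indic_le mulrC.
have iS := integrable_shortfall.
rewrite !FE -RintegralB//; apply/andP; split; apply: le_Rintegral => //.
- exact: (integrableB measurableT (iS v) (iS u)).
- move=> w _; rewrite /shortfall !indic_le.
  by case: (leP (X w) u); case: (leP (X w) v) => /=; lra.
- exact: (integrableB measurableT (iS v) (iS u)).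
- move=> w _; rewrite /shortfall !indic_le.
  by case: (leP (X w) u); case: (leP (X w) v) => /=; lra.
Qed.

(** Decay of [G] at -oo. Pointwise, [X ^+ 2 + t * (t - X)] is half the sum of the squares of [X],
    [t] and [X - t]. *)
Lemma lower_partial_moment_le t : t < 0 ->
  - t * G t <= fine 'E_P[fun w => (X w ^+ 2)%R].
Proof.
move=> t0; rewrite -RintegralZl//; last exact: integrable_shortfall.
rewrite unlock; apply: le_Rintegral => //.
  exact: (integrableZl measurableT (- t) (integrable_shortfall t)).
move=> w _; rewrite /shortfall indic_le.
have := sqr_ge0 (X w - t); have := sqr_ge0 (X w); have := sqr_ge0 t.
by case: (leP (X w) t) => Xt /=; nra.
Qed.

Lemma lower_partial_moment_eq0 t : F t = 0 -> G t = 0.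
Proof.
move=> Ft; have Pt : P [set w | X w <= t] = 0%E.
  by rewrite -cdfE -EFin_real_cdf Ft.
rewrite /lower_partial_moment /Rintegral.
rewrite (_ : integral _ _ _ = 0%E)// -(integral0 P setT).
apply: ae_eq_integral => //.
- by case/integrableP: (integrable_shortfall t).
- exists [set w | X w <= t]; split => //; first exact: measurable_le.
  move=> w /= /not_implyP[_]; apply: contra_notP => /negP Xt.
  by rewrite /shortfall indic_le (negbTE Xt) mulr0.
Qed.

End finite_second_moment.
End lower_partial_moment.

(** * Distribution functions without atoms *)

Lemma is_pdf_set1 d (T : measurableType d) (R : realType)
    (P : probability T R) (X : {RV P >-> R}) (f : R -> R) : is_pdf X f ->
  forall t : R, P [set w | X w = t] = 0%E.
Proof.
move=> [mf _ Xf] t; have := Xf [set t] (measurable_set1 t).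
by rewrite integral_set1.
Qed.

Section atomless.
Context {d : measure_display} {T : measurableType d} {R : realType}
  (P : probability T R).
Variable X : {RV P >-> R}.
Hypothesis X1 : forall t : R, P [set w | X w = t] = 0%E.
Local Notation F := (real_cdf P X).

(* Turns right continuity of the distribution function of [- X] into left
   continuity of [F]. *)
Lemma real_cdf_opp (t : R) : F t = 1 - real_cdf P (- X : {RV P >-> R})%R (- t).
Proof.
suff : (cdf X t + cdf (- X : {RV P >-> R})%R (- t)%R = 1)%E.
  by rewrite -!EFin_real_cdf -EFinD => -[<-]; rewrite addrK.
have mlt : measurable [set w | t < X w].
  rewrite (_ : [set _ | _] = X @^-1` `]t, +oo[); first exact: measurable_funPTI.
  by apply/seteqP; split => w /=; rewrite in_itv/= andbT.
have m1 : measurable [set w | X w = t].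
  exact: (measurable_funPTI X (measurable_set1 t)).
have -> : cdf (- X : {RV P >-> R})%R (- t) = P [set w | t < X w].
  rewrite cdfE (_ : [set _ | _] = [set w | t < X w] `|` [set w | X w = t]).
    rewrite measureU//; last first.
      by apply/seteqP; split => w //= [] + Xt; rewrite Xt ltxx.
    by rewrite [X in (_ + X)%E]X1 adde0.
  apply/seteqP; split => w /=; rewrite lerN2 le_eqVlt.
    by move=> /orP[/eqP->|]; [right|left].
  by move=> [->|->]; rewrite ?eqxx// orbT.
have mle := measurable_le P X t.
rewrite cdfE -measureU//; last first.
  by apply/seteqP; split => w //= [] /le_lt_trans/[apply]; rewrite ltxx.
rewrite (_ : _ `|` _ = setT); first exact: probability_setT.
apply/seteqP; split => w // _ /=.
by case: (leP (X w) t); [left|right].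
Qed.

Lemma real_cdf_right (Y : {RV P >-> R}) (t : R) :
  real_cdf P Y x @[x --> t^'+] --> real_cdf P Y t.
Proof.
apply: fine_cvg; rewrite EFin_real_cdf; exact: cdf_right_continuous.
Qed.

Lemma real_cdf_continuous : continuous F.
Proof.
move=> t; apply/left_right_continuousP; split; last exact: real_cdf_right.
apply/cvg_at_leftNP; rewrite (_ : F \o -%R =
    fun x => 1 - real_cdf P (- X : {RV P >-> R})%R x).
  by rewrite real_cdf_opp; apply: cvgB; [exact: cvg_cst|exact: real_cdf_right].
by apply/funext => x /=; rewrite real_cdf_opp opprK.
Qed.

(** As [v] is not an atom, the open interval from [u] to [v] has mass [F v - F u > 0], so [X] cannot
    stay there inside the null set where [Q] fails. This supplies the density assumption of
    [proportional_between]. *)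
Lemma real_cdf_lt_ae (Q : R -> Prop) (u v : R) : {ae P, forall w, Q (X w)} ->
  F u < F v -> exists2 s, u < s < v & Q s.
Proof.
move=> QX Fuv; apply: contrapT => nQ.
have [N [mN PN0 QN]] := QX.
suff : F v <= F u by rewrite leNgt Fuv.
rewrite -lee_fin !EFin_real_cdf !cdfE.
have m1 : measurable [set w | X w = v].
  exact: (measurable_funPTI X (measurable_set1 v)).
have mu := measurable_le P X u.
have mNv : measurable (N `|` [set w | X w = v]) by exact: measurableU.
have PNv : P (N `|` [set w | X w = v]) = 0%E.
  apply/eqP; rewrite -measure_le0 (le_trans (measureU2 P mN m1))//.
  by rewrite [X in (X + _)%E]PN0 [X in (_ + X)%E]X1 adde0.
rewrite -[leRHS]adde0 -PNv.
apply: le_trans (measureU2 P mu mNv); apply: le_measure.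
- by rewrite inE; exact: measurable_le.
- by rewrite inE; exact: measurableU.
move=> w /=; rewrite le_eqVlt => /orP[/eqP Xv|Xv]; first by right; right.
have [Xu|Xu] := leP (X w) u; [by left|right; left].
by apply: QN => /= Qw; apply: nQ; exists (X w); rewrite ?Xu.
Qed.

Lemma real_cdf_lt_left (t : R) : 0 < F t -> exists2 u, u < t & F u < F t.
Proof.
move=> Ft; have : F @ -oo%R --> (0 : R) by exact: fine_cvg (cvg_cdfNy0 X).
move=> /cvgr_lt/(_ _ Ft) H.
have /filter_ex[u [Fu ut]] : \forall u \near -oo%R, F u < F t /\ u < t.
  by apply: filterI => //; exact: nbhs_ninfty_lt (num_real t).
by exists u.
Qed.

Lemma real_cdf_lt_right (t : R) : F t < 1 -> exists2 v, t < v & F t < F v.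
Proof.
move=> Ft; have : F @ +oo%R --> (1 : R) by exact: fine_cvg (cvg_cdfy1 X).
move=> /cvgr_gt/(_ _ Ft) H.
have /filter_ex[u [Fu ut]] : \forall u \near +oo%R, F t < F u /\ t < u.
  by apply: filterI => //; exact: nbhs_pinfty_gt (num_real t).
by exists u.
Qed.

(** The zero set of [F] is closed and bounded above. If nonempty it contains its supremum [s], and
    [F (X w) = 0] implies [X w <= s], an event of probability [F s = 0]. *)
Lemma real_cdf_gt0_ae : {ae P, forall w, 0 < F (X w)}.
Proof.
pose Z := [set t | F t = 0].
have [[t Zt]|Z0] := pselect (Z !=set0); last first.
  apply: aeW => w; rewrite lt_neqAle real_cdf_ge0 andbT eq_sym.
  by apply/eqP => Fw; apply: Z0; exists (X w).
have Zb : has_ubound Z.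
  have [|v tv Ftv] := real_cdf_lt_right t; first by rewrite Zt.
  exists v => z Zz; rewrite leNgt; apply/negP => /ltW/(le_real_cdf P X).
  by rewrite Zz leNgt -{1}Zt Ftv.
have : Z (sup Z).
  have cZ : closed Z.
    apply: (@closed_comp _ _ F [set 0]) => [x _|]; last exact: closed_eq.
    exact: real_cdf_continuous.
  by apply: cZ; apply: closure_sup => //; exists t.
rewrite /Z/= => Fs.
exists [set w | X w <= sup Z]; split.
- exact: measurable_le.
- by rewrite -cdfE -EFin_real_cdf Fs.
- move=> w /= /negP; rewrite -leNgt => Fw.
  apply: ub_le_sup => //=; apply/eqP.
  by rewrite eq_le Fw real_cdf_ge0.
Qed.

End atomless.

(** * Positivity of [m(X)] and the case where it is constant *)

Section equality.
Context {d : measure_display} {T : measurableType d} {R : realType}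
  (P : probability T R).
Variables (X : {RV P >-> R}) (b : R).
Hypothesis X1 : forall t : R, P [set w | X w = t] = 0%E.
Hypothesis X2 : ('E_P[fun w => (X w ^+ 2)%R] < +oo)%E.
Local Notation F := (real_cdf P X).
Local Notation G := (lower_partial_moment P X).
Local Notation m := (expected_inactivity_time X).

Lemma is_derive_lower_partial_moment (t : R) : is_derive t 1 G (F t).
Proof.
apply: is_derive_of_slopes; first exact: real_cdf_continuous.
exact: lower_partial_moment_slopes.
Qed.

Lemma lower_partial_moment_continuous : continuous G.
Proof.
move=> t; apply: differentiable_continuous; apply/derivable1_diffP.
by case: (is_derive_lower_partial_moment t).
Qed.

Lemma expected_inactivity_time_ge0 (t : R) : 0 <= m t.
Proof.
rewrite expected_inactivity_timeE.
by rewrite divr_ge0// ?lower_partial_moment_ge0// real_cdf_ge0.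
Qed.

(** By continuity [F s > 0] for some [s < t], and then [G t >= G s + F s * (t - s) > 0]. *)
Lemma lower_partial_moment_gt0 (t : R) : 0 < F t -> 0 < G t.
Proof.
move=> Ft; rewrite lt_neqAle lower_partial_moment_ge0 andbT eq_sym.
apply/eqP => Gt.
have : F x @[x --> t^'-] --> F t.
  by apply: cvg_at_left_filter; exact: real_cdf_continuous.
move=> /cvgr_gt/(_ _ Ft) H; near t^'- => s.
have Fs : 0 < F s by near: s.
have st : s < t by near: s; exact: nbhs_left_lt.
have /andP[+ _] := lower_partial_moment_slopes P X X2 s t (ltW st).
have : 0 < F s * (t - s) by rewrite mulr_gt0// subr_gt0.
by have := lower_partial_moment_ge0 P X s; rewrite Gt; lra.
Unshelve. all: by end_near. Qed.

Lemma expected_inactivity_time_gt0_ae : {ae P, forall w, 0 < m (X w)}.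
Proof.
apply: filterS (real_cdf_gt0_ae P X X1) => w Fw.
by rewrite expected_inactivity_timeE divr_gt0// lower_partial_moment_gt0.
Qed.

Lemma measurable_expected_inactivity_time :
  measurable_fun setT (fun w => m (X w)).
Proof.
under eq_fun do rewrite expected_inactivity_timeE.
apply: measurable_funM.
  apply: measurableT_comp => //; apply: continuous_measurable_fun.
  exact: lower_partial_moment_continuous.
apply: (measurableT_comp (measurable_inv R)).
apply: measurableT_comp => //; apply: continuous_measurable_fun.
exact: real_cdf_continuous.
Qed.

Hypothesis Xlt : forall t : R, t < b -> F t < 1.
Hypothesis Xb : F b = 1.

Lemma real_cdf_ge (t : R) : b <= t -> F t = 1.
Proof.
move=> bt; apply/eqP; rewrite eq_le -{2}Xb le_real_cdf// andbT.
by rewrite -lee_fin EFin_real_cdf cdf_le1.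
Qed.

Lemma expected_inactivity_time_cst_ae (mu : R) : 0 < mu ->
  {ae P, forall w, m (X w) = mu} ->
  forall t, cdf X t = (type3_cdf mu^-1 b t)%:E.
Proof.
move=> mu0 mX t; rewrite -EFin_real_cdf /type3_cdf; congr (_%:E).
have [tb|/ltW/real_cdf_ge//] := leP t b.
have cF := real_cdf_continuous P X X1.
apply: (proportional_expR R F G b is_derive_lower_partial_moment) => //.
move=> {tb}t tb.
(* Where [F] vanishes so does [G]. Elsewhere [0 < F t < 1], the upper bound by [t < b], so [F] takes
   smaller values to the left and larger ones to the right. *)
have [Ft|Ft] : F t = 0 \/ 0 < F t.
- by have := real_cdf_ge0 P X t; rewrite le_eqVlt => /orP[/eqP|]; [left|right].
- by rewrite Ft mulr0; exact: lower_partial_moment_eq0.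
have [p _ Fp] := real_cdf_lt_left P X t Ft.
have [q _ Fq] := real_cdf_lt_right P X t (Xlt t tb).
apply: (proportional_between R F G mu cF lower_partial_moment_continuous
  (le_real_cdf P X) _ _ p t q) => // u v.
  by move=> /(lower_partial_moment_slopes P X X2)/andP[].
apply: real_cdf_lt_ae => //.
apply: filterS2 mX (real_cdf_gt0_ae P X X1) => w <- Fw.
by rewrite expected_inactivity_timeE divfK// gt_eqF.
Qed.

Lemma type3_expected_inactivity_time_ae (gamma : R) : 0 < gamma ->
  (forall t, cdf X t = (type3_cdf gamma b t)%:E) ->
  {ae P, forall w, m (X w) = gamma^-1}.
Proof.
move=> g0 XE.
(* The identity [G = F / gamma] is available up to [b] only, and [X <= b] almost surely since
   [F b = 1]. *)
have Xleb : {ae P, forall w, X w <= b}.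
  have mle := measurable_le P X b.
  exists (~` [set w | X w <= b]); split => //; first exact: measurableC.
  by rewrite probability_setC// -cdfE -EFin_real_cdf Xb subee.
apply: filterS Xleb => w Xw.
have FE t : t <= b -> F t = expR (gamma * (t - b)).
  by move=> tb; rewrite /real_cdf XE /type3_cdf tb.
rewrite expected_inactivity_timeE.
rewrite (expR_proportional R F G b is_derive_lower_partial_moment gamma
  (fine 'E_P[fun w => (X w ^+ 2)%R]))//.
- by rewrite FE// mulfK// gt_eqF// expR_gt0.
- exact: lower_partial_moment_ge0.
- exact: lower_partial_moment_le.
Qed.

End equality.

(** * Right endpoint of the support, and conclusion *)

Lemma is_support_lt d (T : measurableType d) (R : realType)
    (P : probability T R) (X : {RV P >-> R}) (a : \bar R) (b : R) :
  is_support X a b%:E -> forall t, t < b -> real_cdf P X t < 1.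
Proof.
move=> [_ bE] t tb; have : (t%:E < b%:E)%E by rewrite lte_fin.
rewrite bE => /ereal_sup_gt[_ [s Fs <-]]; rewrite lte_fin => ts.
apply: le_lt_trans (le_real_cdf P X _ _ (ltW ts)) _.
by rewrite -lte_fin EFin_real_cdf.
Qed.

(** The supremum yields [F = 1] strictly to the right of [b]; right continuity carries this to
    [b]. *)
Lemma is_support_sup d (T : measurableType d) (R : realType)
    (P : probability T R) (X : {RV P >-> R}) (a : \bar R) (b : R) :
  is_support X a b%:E -> real_cdf P X b = 1.
Proof.
move=> [_ bE]; apply: (@cvg_unique _ _ (real_cdf P X x @[x --> b^'+])) => //.
  exact: real_cdf_right.
apply: (@cvg_trans _ ((fun=> 1 : R) @ b^'+)); last exact: cvg_cst.
apply: near_eq_cvg; near=> x; apply/esym/eqP.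
rewrite eq_le -!lee_fin EFin_real_cdf cdf_le1/= leNgt; apply/negP => Fx.
have : (x%:E <= b%:E)%E by rewrite bE; apply: ereal_sup_ubound; exists x.
by rewrite lee_fin leNgt => /negP; apply; near: x; exact: nbhs_right_gt.
Unshelve. all: by end_near. Qed.

Local Open Scope ereal_scope.

Theorem theorem3p1 (d : measure_display) (T : measurableType d) (R : realType)
    (P : probability T R) (X : {RV P >-> R}) (f : R -> R) (a : \bar R) (b : R)
    (Xf : is_pdf X f)
    (Xab : is_support X a b%:E) (ab : a < b%:E)
    (X2 : 'E_P[fun w => (X w ^+ 2)%R] < +oo) :
  let m := expected_inactivity_time X in
  ('E_P[fun w => m (X w)])^-1 <= 'E_P[fun w => (m (X w))^-1%R] /\
  ('E_P[fun w => (m (X w))^-1%R] = ('E_P[fun w => m (X w)])^-1 <->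
   exists2 gamma : R, (0 < gamma)%R &
     forall t : R, cdf X t = (type3_cdf gamma b t)%:E).
Proof.
move=> m; have X1 := is_pdf_set1 _ _ _ _ _ _ Xf.
have mm := measurable_expected_inactivity_time P X X1 X2.
have m0 w := expected_inactivity_time_ge0 P X (X w).
have mpos := expected_inactivity_time_gt0_ae P X X1 X2.
have Flt := is_support_lt _ _ _ _ _ _ _ Xab.
have Fb := is_support_sup _ _ _ _ _ _ _ Xab.
split; first exact: expectation_inv_ge.
split=> [/expectation_inv_eq[]// mu mu0 mE|[gamma g0 XE]].
  exists mu^-1%R; first by rewrite invr_gt0.
  exact: expected_inactivity_time_cst_ae.
have mE : {ae P, forall w, m (X w) = gamma^-1%R}.
  exact: (type3_expected_inactivity_time_ae P X b).
(* Both sides are expectations of almost sure constants: [E m(X) = gamma^-1] and [E[1 / m(X)] =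
   gamma]. *)
rewrite (expectation_cst_ae _ _ _ P _ gamma^-1 mm mE).
rewrite (expectation_cst_ae _ _ _ P _ gamma).
- by rewrite inver invr_eq0 gt_eqF// invrK.
- exact: measurableT_comp (measurable_inv R) mm.
- by apply: filterS mE => w ->; rewrite invrK.
Qed.
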